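(* Let $x,x_1\in\mathbb{R}^n$, $p>0$ and $\sigma,y\in\mathbb{R}$, and let $m(x;x_1)=\|x-x_1\|^{-p}+\sigma$. Assume that $m(x;x_1)$ is finite, that $m(x;x_1)>0$, and that $y>\sigma$. Then the deflation constraint $$m(x;x_1)\le y$$ is equivalent to the minimum distance constraint $$\|x-x_1\|^{p}\ge z,\qquad\text{where } z=\frac{1}{y-\sigma}.$$
   Context: $\|\cdot\|$ is the Euclidean norm. The function $m(\cdot;x_1)$ is called the deflation function, with power $p$ and shift $\sigma$; $x_1$ is a known solution of an optimization problem that one wants to avoid. By convention $m(x_1;x_1)=+\infty$ (since $\lim_{x\to x_1}m(x;x_1)=\infty$), so finiteness of $m(x;x_1)$ means $x\ne x_1$. *)

(* Defs.v *)
From mathcomp Require Import all_boot all_order all_algebra.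
From mathcomp Require Import reals constructive_ereal ereal exp.

Set Implicit Arguments.
Unset Strict Implicit.
Unset Printing Implicit Defensive.

Import Order.TTheory GRing.Theory Num.Theory.
Local Open Scope ring_scope.

(* The library norm on ['rV[R]_n] is the sup norm, hence this definition. *)
Definition enorm (R : realType) (n : nat) (v : 'rV[R]_n) : R :=
  Num.sqrt (\sum_(i < n) v ord0 i ^+ 2).

(* Extended-real valued: the value at [x1] is [+oo] by convention. The case
   distinction is needed because [powR 0 (- p)] is [0] for [p != 0]. *)
Definition deflation (R : realType) (n : nat) (p sigma : R) (x1 x : 'rV[R]_n) :
    \bar R :=
  if x == x1 then +oo%E else (powR (enorm (x - x1)) (- p) + sigma)%:E.

(* Main.v *)
Require Import Defs.
From mathcomp Require Import all_boot all_order all_algebra.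
From mathcomp Require Import reals constructive_ereal ereal exp.
Import Order.TTheory GRing.Theory Num.Theory.
Local Open Scope ring_scope.

(** Finiteness forces [x != x1], so by [enorm_gt0] the distance and its [p]-th power are positive.
    Moving [sigma] across, the constraint bounds the inverse of that power by [y - sigma]; inverting
    reverses the inequality. *)

Lemma enorm_gt0 (R : realType) (n : nat) (v : 'rV[R]_n) :
  v != 0 -> 0 < enorm v.
Proof.
(* A nonzero coordinate is split off: its square makes the sum positive. *)
case/rV0Pn=> i vi_neq0; rewrite /enorm sqrtr_gt0 (bigD1 i) //=.
rewrite ltr_pwDl ?exprn_even_gt0 //.
by apply: sumr_ge0 => j _; exact: sqr_ge0.
Qed.

Theorem mainTheorem3 (R : realType) (n : nat) (x x1 : 'rV[R]_n)
    (p sigma y : R) (hp : 0 < p)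
    (hfin : deflation p sigma x1 x \is a fin_num)
    (hpos : (0 < deflation p sigma x1 x)%E)
    (hy : sigma < y) :
  let z := 1 / (y - sigma) in
  (deflation p sigma x1 x <= y%:E)%E <-> z <= powR (enorm (x - x1)) p.
Proof.
move: hfin; rewrite /deflation; case: eqVneq => [//|x_neq_x1 _] /=.
have norm_gt0 : 0 < powR (enorm (x - x1)) p.
  by rewrite powR_gt0 ?enorm_gt0 ?subr_eq0.
rewrite lee_fin powRN -lerBrDr div1r.
(* Inversion is antitone on positives; [hy] makes [y - sigma] positive. *)
by rewrite -[_^-1 <= y - sigma]lef_pV2 ?posrE ?invr_gt0 ?subr_gt0 // invrK.
Qed.
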